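(* Let $\underline T=(T_1,\dots,T_d)$ be a $d$-tuple of commuting contractions on a Hilbert space $\mathcal H$. Suppose that $\underline T^*=(T_1^*,\dots,T_d^* )$ has a minimal isometric dilation $\underline V=(V_1,\dots,V_d)$ on $\mathcal K\supseteq\mathcal H$ whose unitary part $\underline U=(U_1,\dots,U_d)$, acting on $\mathcal F\subseteq\mathcal K$, is non-zero (i.e., $\mathcal F\neq\{0\}$). Then $\underline U^*=(U_1^*,\dots,U_d^* )$ is a unitary pseudo-extension of $\underline T$.
   Context: Hilbert spaces are complex; operators are bounded and linear. Dilation: a $d$-tuple $\underline V=(V_1,\dots,V_d)$ of commuting bounded operators on a Hilbert space $\mathcal K$ is a dilation of a $d$-tuple $\underline S=(S_1,\dots,S_d)$ of commuting bounded operators on $\mathcal H$ if $\mathcal H$ is a subspace of $\mathcal K$ and $V_i^*|_{\mathcal H}=S_i^*$ for all $i$. It is isometric if all $V_i$ are isometries, and an isometric dilation is minimal if $\mathcal K$ is the closed linear span of $\{V_1^{n_1}\cdots V_d^{n_d}h: h\in\mathcal H,\ n_1,\dots,n_d\ge 0\}$. Unitary part: for a $d$-tuple $\underline V$ of commuting isometries on $\mathcal K$ with product $V=V_1\cdots V_d$, let $\mathcal F=\bigcap_{n\ge0}V^n\mathcal K$ be the space of the unitary summand in the Wold decomposition of $V$. By a theorem of Berger, Coburn and Lebow, $\mathcal F$ reduces every $V_j$ and each $V_j|_{\mathcal F}$ is unitary; the commuting unitary tuple $(V_1|_{\mathcal F},\dots,V_d|_{\mathcal F})$ is called the unitary part of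 $\underline V$. Pseudo-extension: a $d$-tuple $\underline W=(W_1,\dots,W_d)$ of commuting bounded operators on a Hilbert space $\mathcal L$ is a pseudo-extension of $\underline T$ on $\mathcal H$ if there is a non-zero contraction $\mathfrak J:\mathcal H\to\mathcal L$ with $\mathfrak JT_j=W_j\mathfrak J$ for every $j=1,\dots,d$; it is a unitary pseudo-extension if every $W_j$ is unitary. *)

(* Defs.v *)
From HB Require Import structures.
From mathcomp Require Import all_boot all_order all_algebra.
From mathcomp Require Import sesquilinear complex.
From mathcomp Require Import boolp classical_sets functions reals topology.
From mathcomp Require Import normedtype ring lra.
Import numFieldNormedType.Exports.

Set Implicit Arguments.
Unset Strict Implicit.
Unset Printing Implicit Defensive.
Import Order.TTheory GRing.Theory Num.Theory.
Local Open Scope classical_set_scope.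
Local Open Scope ring_scope.
Local Open Scope complex_scope.

(* The inner product is linear in its first argument and conjugate-linear in
   its second one. *)
HB.mixin Record isHilbert (R : realType) H of CompleteNormedModule R[i] H := {
  hdot : {dot H for Num.conj};
  sqr_hnorm : forall x : H, `|x| ^+ 2 = hdot x x }.
#[short(type="hilbertType")]
HB.structure Definition Hilbert (R : realType) :=
  {H of isHilbert R H & CompleteNormedModule R[i] H}.

Section Operators.
Variable R : realType.
Implicit Types H K L : hilbertType R.

Definition bounded_operator H L (f : H -> L) :=
  exists2 M, 0 <= M & forall x, `|f x| <= M * `|x|.

Record bop H L := Bop {
  bop_fun :> {linear H -> L};
  bopP : bounded_operator bop_fun }.

Lemma bop_continuous H L (f : bop H L) : continuous f.
Proof.
apply: bounded_linear_continuous; apply/linear_boundedP.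
have [M M0 fM] := bopP f; near=> r => x.
apply: le_trans (fM x) _; rewrite ler_wpM2r //.
by near: r; apply: nbhs_pinfty_ge; exact: ger0_real.
Unshelve. all: by end_near. Qed.

Lemma bid_bounded H : bounded_operator (idfun : H -> H).
Proof. by exists 1 => // x; rewrite mul1r. Qed.
Definition bid H : bop H H := Bop (@bid_bounded H).

Lemma bcomp_bounded H K L (f : bop K L) (g : bop H K) :
  bounded_operator (f \o g).
Proof.
have [M M0 fM] := bopP f; have [N N0 gN] := bopP g.
exists (M * N) => [|x /=]; first exact: mulr_ge0.
by rewrite (le_trans (fM _)) // -mulrA ler_wpM2l.
Qed.
Definition bcomp H K L (f : bop K L) (g : bop H K) : bop H L :=
  Bop (bcomp_bounded f g).

Fixpoint bexp H (f : bop H H) (n : nat) : bop H H :=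
  if n is n'.+1 then bcomp f (bexp f n') else bid H.

Definition bprod H d (f : 'I_d -> bop H H) : bop H H :=
  \big[@bcomp H H H / bid H]_(j < d) f j.

Definition commuting H d (T : 'I_d -> bop H H) :=
  forall i j x, T i (T j x) = T j (T i x).

Definition contraction_op H L (f : bop H L) := forall x, `|f x| <= `|x|.
Definition isometry_op H L (f : bop H L) := forall x, `|f x| = `|x|.

End Operators.


Section Subspace.
Variables (R : realType) (K : hilbertType R).

Record closed_subspace := ClosedSubspace {
  subspace_set :> set K;
  subspace0 : subspace_set 0;
  subspaceP : forall (a : R[i]) x y,
    subspace_set x -> subspace_set y -> subspace_set (a *: x + y);
  subspace_closed : closed subspace_set }.

Variable S : closed_subspace.

Definition subspace_mem : {pred K} := fun x => x \in subspace_set S.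

Lemma subspace_memP x : (x \in subspace_mem) <-> subspace_set S x.
Proof. by rewrite unfold_in /subspace_mem inE. Qed.

Record subspace_sort := InSubspace {
  subspace_val : K;
  subspace_valP : subspace_val \in subspace_mem }.

HB.instance Definition _ := [isSub for subspace_val].
HB.instance Definition _ := [Choice of subspace_sort by <:].

Lemma subspace_submod_closed : submod_closed subspace_mem.
Proof.
split=> [|a x y]; first by apply/subspace_memP; exact: subspace0.
by move=> /subspace_memP Sx /subspace_memP Sy; apply/subspace_memP; exact: subspaceP.
Qed.
HB.instance Definition _ :=
  GRing.isSubmodClosed.Build _ _ subspace_mem subspace_submod_closed.
HB.instance Definition _ := [SubChoice_isSubLmodule of subspace_sort by <:].

Lemma subspace_val_linear : linear subspace_val.
Proof. by move=> a x y; rewrite -[subspace_val]/val linearP. Qed.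
HB.instance Definition _ :=
  GRing.isLinear.Build R[i] subspace_sort K *:%R subspace_val subspace_val_linear.

Lemma subspace_valB (x y : subspace_sort) : subspace_val (x - y) = subspace_val x - subspace_val y.
Proof. exact: raddfB. Qed.

Lemma subspace_normD (x y : subspace_sort) :
  `|subspace_val (x + y)| <= `|subspace_val x| + `|subspace_val y|.
Proof. by rewrite raddfD ler_normD. Qed.
Lemma subspace_normZ (a : R[i]) (x : subspace_sort) :
  `|subspace_val (a *: x)| = `|a| * `|subspace_val x|.
Proof. by rewrite linearZ normrZ. Qed.
Lemma subspace_norm0_eq0 (x : subspace_sort) : `|subspace_val x| = 0 -> x = 0.
Proof. by move/normr0_eq0 => x0; apply: val_inj; rewrite raddf0. Qed.
HB.instance Definition _ := Lmodule_isNormed.Build R[i] subspace_sort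
  subspace_normD subspace_normZ subspace_norm0_eq0.

Lemma subspace_normE (x : subspace_sort) : `|x| = `|subspace_val x|.
Proof. by []. Qed.

Lemma subspace_sort_complete (F : set_system subspace_sort) :
  ProperFilter F -> cauchy F -> cvg F.
Proof.
move=> FF /cauchy_ballP Fc.
have /cauchy_cvgP : cauchy (subspace_val @ F).
  apply/cauchy_ballP => e e0; rewrite near_map2; apply: filterS (Fc e e0) => -[x y].
  by rewrite -!ball_normE /= subspace_normE subspace_valB.
move=> /cvg_ex [p Fp].
have SF : \forall x \near F, subspace_set S (subspace_val x).
  by apply: nearW => x; apply/subspace_memP; exact: subspace_valP.
have Sp : p \in subspace_mem.
  apply/subspace_memP.
  exact: (closed_cvg (FF := FF) _ (@subspace_closed S) SF p Fp).
suff : F --> InSubspace Sp by exact: cvgP.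
apply/cvgrPdist_lt => e e0; move/cvgrPdist_lt: Fp => /(_ e e0).
by apply: filterS => x; rewrite subspace_normE subspace_valB.
Qed.
HB.instance Definition _ :=
  Uniform_isComplete.Build subspace_sort subspace_sort_complete.

Definition subspace_dot (x y : subspace_sort) : R[i] := hdot (subspace_val x) (subspace_val y).

Lemma subspace_dot_bilinear :
  bilinear_for *%R (Num.conj \; *%R) subspace_dot.
Proof.
split=> [y|x] a u v; rewrite /subspace_dot subspace_val_linear.
  exact: linearPl.
exact: linearPr.
Qed.
HB.instance Definition _ := bilinear_isBilinear.Build _ _ _ _ _ _
  subspace_dot subspace_dot_bilinear.
Lemma subspace_dot_herm (x y : subspace_sort) :
  subspace_dot x y = (-1) ^+ false * (subspace_dot y x)^*.
Proof. exact: hermitian_subproof. Qed.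
HB.instance Definition _ := isHermitianSesquilinear.Build _ _ _ _
  subspace_dot subspace_dot_herm.
Lemma subspace_dot_gt0 (x : subspace_sort) : x != 0 -> 0 < subspace_dot x x.
Proof. by move=> x0; apply: neq0_dnorm_gt0; rewrite (raddf_eq0 _ val_inj). Qed.
HB.instance Definition _ := isDotProduct.Build _ _ subspace_dot subspace_dot_gt0.

Lemma subspace_sqr_norm (x : subspace_sort) :
  `|x| ^+ 2 = (subspace_dot : {dot subspace_sort for Num.conj}) x x.
Proof. exact: sqr_hnorm. Qed.
HB.instance Definition _ := isHilbert.Build R subspace_sort subspace_sqr_norm.

End Subspace.

Section Adjoint.
Variable R : realType.
Implicit Types H K L : hilbertType R.

Lemma hdot_project H (u y : H) : y != 0 ->
  `|u - (hdot u y / `|y| ^+ 2) *: y| ^+ 2 =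
  `|u| ^+ 2 - `|hdot u y| ^+ 2 / `|y| ^+ 2.
Proof.
move=> y0; have n0 : `|y| ^+ 2 != 0 by rewrite expf_neq0 // normr_eq0.
set n := `|y| ^+ 2; set c := hdot u y.
have nr : Num.conj n = n by rewrite geC0_conj // exprn_ge0.
have e : hdot u ((c / n) *: y) = `|c| ^+ 2 / n.
  rewrite linearZr_LR /= -/c normCK; rewrite rmorphM /= fmorphV /= nr.
  by rewrite mulrC mulrA.
rewrite sqr_hnorm dnormB -!sqr_hnorm e normrZ exprMn.
have -> : Num.conj (`|c| ^+ 2 / n) = `|c| ^+ 2 / n.
  by rewrite geC0_conj // divr_ge0 // exprn_ge0.
rewrite normf_div (ger0_norm (exprn_ge0 _ _)) // -/n exprMn exprVn.
by rewrite -/n; field.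
Qed.

Lemma hdot_cauchy_schwarz H (u y : H) : `|hdot u y| <= `|u| * `|y|.
Proof.
have [->|y0] := eqVneq y 0; first by rewrite linear0r !normr0 mulr0.
rewrite -ler_sqr ?nnegrE ?mulr_ge0 // exprMn -ler_pdivrMr ?exprn_gt0 ?normr_gt0 //.
by rewrite -subr_ge0 -hdot_project // exprn_ge0.
Qed.

Lemma hdot_parallelogram H (u v : H) :
  `|u + v| ^+ 2 + `|u - v| ^+ 2 = 2 * `|u| ^+ 2 + 2 * `|v| ^+ 2.
Proof. by rewrite !sqr_hnorm dnormD dnormB; ring. Qed.

Lemma hdot_inj H (u v : H) : (forall x, hdot x u = hdot x v) -> u = v.
Proof.
move=> uv; apply/eqP; rewrite -subr_eq0 -normr_eq0 -sqrf_eq0 sqr_hnorm.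
by rewrite linearBr /= uv subrr.
Qed.

Let rn H (x : H) : R := complex.Re `|x|.
Let rnE H (x : H) : (rn x)%:C = `|x|.
Proof. exact/RRe_real/normr_real. Qed.
Let rn_le H (x y : H) : (rn x <= rn y) = (`|x| <= `|y|).
Proof. by rewrite -!rnE lecR. Qed.
Let rn_ge0 H (x : H) : 0 <= rn x.
Proof. by rewrite -ler0c rnE. Qed.

Lemma nearest_point H (S : closed_subspace H) (x : H) :
  exists2 p, subspace_set S p & forall s, subspace_set S s -> `|x - p| <= `|x - s|.
Proof.
have SB s t : subspace_set S s -> subspace_set S t -> subspace_set S (s + t).
  by move=> Ss St; rewrite -[s]scale1r; exact: subspaceP.
have SZ (a : R[i]) s : subspace_set S s -> subspace_set S (a *: s).
  by move=> Ss; rewrite -[_ *: _]addr0; apply: subspaceP => //; exact: subspace0.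
pose E := [set rn (x - s) | s in subspace_set S]; pose d := inf E.
have hE : has_inf E.
  split; first by exists (rn (x - 0)), 0 => //; exact: subspace0.
  by exists 0 => _ [s _ <-]; exact: rn_ge0.
have d_le s : subspace_set S s -> d <= rn (x - s).
  by move=> Ss; apply: (ge_inf hE.2); exists s.
have d0 : 0 <= d by apply: lb_le_inf hE.1 _ => _ [s _ <-]; exact: rn_ge0.
pose A e := [set s | subspace_set S s /\ rn (x - s) < d + e].
pose F := filter_from [set e : R | 0 < e] A.
have FF : ProperFilter F.
  apply: filter_from_proper.
    apply: filter_from_filter; first by exists 1; exact: ltr01.
    move=> i j i0 j0; exists (Num.min i j); first by rewrite /= lt_min i0.
    by move=> s [Ss]; rewrite -ltrBlDl lt_min !ltrBlDl => /andP[? ?].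
  move=> e e0; have [_ [s Ss <-] ?] := inf_adherent e0 hE.
  by exists s.
have key e s t : 0 < e -> A e s -> A e t -> rn (s - t) ^+ 2 <= 4 * e * (2 * d + e).
  move=> e0 [Ss xs] [St xt].
  pose m := 2^-1 *: (s + t).
  have := hdot_parallelogram (x - t) (x - s).
  have -> : x - t + (x - s) = (2 : R[i]) *: (x - m).
    rewrite /m scalerBr scalerA divff ?pnatr_eq0 // scale1r scaler_nat mulr2n.
    by rewrite opprD addrACA (addrC (- t)).
  have -> : x - t - (x - s) = s - t by rewrite opprB addrC addrA subrK.
  rewrite normrZ ger0_norm // exprMn -!rnE.
  have -> : (2 : R[i]) = (2 : R)%:C by rewrite rmorph_nat.
  rewrite -!rmorphXn -!rmorphM -!rmorphD => /complexI.
  have : d <= rn (x - m) by apply: d_le; apply: SZ; exact: SB.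
  have := rn_ge0 (x - t); have := rn_ge0 (x - s).
  move: xs xt; move: (rn _) (rn (x - t)) (rn (x - m)) (rn _) => a b c r.
  by move=> *; nra.
have Fc : cauchy F.
  apply: (@cauchy_exP R[i]) => eps eps0.
  have eE : (complex.Re eps)%:C = eps by apply/RRe_real/gtr0_real.
  pose e := complex.Re eps; have e0 : 0 < e by rewrite -ltcR eE.
  pose dl := Num.min 1 (e ^+ 2 / (8 * d + 5)).
  have dpos : 0 < 8 * d + 5 by lra.
  have dl0 : 0 < dl by rewrite lt_min ltr01 divr_gt0 // exprn_gt0.
  have dl1 : dl <= 1 by rewrite ge_min lexx.
  have dle : dl * (8 * d + 5) <= e ^+ 2.
    by rewrite -ler_pdivlMr // ge_min lexx orbT.
  have [_ [s Ss <-] xs] := inf_adherent dl0 hE.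
  exists s, dl => // t At; rewrite -ball_normE /= -rnE -eE ltcR.
  rewrite -ltr_sqr ?nnegrE ?rn_ge0 ?ltW //.
  apply: le_lt_trans (key _ _ _ dl0 _ At) _; first by split.
  by apply: lt_le_trans dle; nra.
have /cvg_ex [p Fp] : cvg F by apply/cauchy_cvgP.
have Sp : subspace_set S p.
  apply: (closed_cvg (FF := FF) _ (@subspace_closed _ _ S) _ p Fp).
  by exists 1; [exact: ltr01|move=> s []].
exists p => // s Ss; rewrite -rn_le; apply: le_trans (d_le _ Ss).
apply/ler_addgt0Pr => e e0.
have e2 : 0 < e / 2 by rewrite divr_gt0.
have e2C : 0 < (e / 2)%:C by rewrite ltcR.
have Fq : F (ball p (e / 2)%:C) by apply: Fp; exact: nbhsx_ballx.
have FA : F (A (e / 2)) by exists (e / 2).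
have [q [pq [_ xq]]] := filter_ex (filterI Fq FA).
move: pq; rewrite -ball_normE /= => pq.
have /(le_trans _) : `|x - p| <= `|x - q| + `|p - q|.
  by rewrite (distrC p q) (le_trans _ (ler_normD _ _)) // addrA subrK.
move=> /(_ _ (lexx _)); move: pq; rewrite -!rnE ltcR -rmorphD lecR.
by move=> *; lra.
Qed.

Lemma orthogonal_projection H (S : closed_subspace H) (x : H) :
  exists2 p, subspace_set S p & forall s, subspace_set S s -> hdot (x - p) s = 0.
Proof.
have [p Sp xp] := nearest_point S x; exists p => // s Ss.
have [->|s0] := eqVneq s 0; first by rewrite linear0r.
have ns : 0 < `|s| ^+ 2 by rewrite exprn_gt0 // normr_gt0.
pose t := hdot (x - p) s / `|s| ^+ 2.
have /xp : subspace_set S (t *: s + p) by exact: subspaceP.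
rewrite opprD addrCA addrC -ler_sqr ?nnegrE // (hdot_project _ s0).
rewrite lerBrDr gerDl pmulr_lle0 ?invr_gt0 // => c0.
apply/eqP; rewrite -normr_eq0 -sqrf_eq0 eq_le c0 exprn_ge0 //.
Qed.

Lemma riesz_representation H L (f : bop H L) (y : L) :
  exists z, forall x, hdot (f x) y = hdot x z.
Proof.
have [M M0 fM] := bopP f.
pose N := [set x | hdot (f x) y = 0].
have N0 : N 0 by rewrite /N /= linear0 linear0l.
have NP (a : R[i]) u v : N u -> N v -> N (a *: u + v).
  by rewrite /N /= linearP linearPl /= => -> ->; rewrite mulr0 addr0.
have Nc : closed N.
  move=> x clx; rewrite /N /=; apply/eqP/negPn/negP => fx.
  pose e := `|hdot (f x) y| / (M * `|y| + 1).
  have p0 : 0 < M * `|y| + 1 by rewrite ltr_wpDl // mulr_ge0.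
  have e0 : 0 < e by rewrite divr_gt0 // normr_gt0.
  have [z [Nz]] := clx _ (nbhsx_ballx x e e0).
  rewrite -ball_normE /= => xz.
  have : `|hdot (f x) y| <= M * `|x - z| * `|y|.
    have -> : hdot (f x) y = hdot (f (x - z)) y by rewrite linearB linearBl /= Nz subr0.
    by rewrite (le_trans (hdot_cauchy_schwarz _ _)) // ler_wpM2r.
  apply/negP; rewrite lt_geF // mulrAC.
  rewrite -[ltRHS](divfK (lt0r_neq0 p0)) mulrC.
  apply: (@le_lt_trans _ _ (e * (M * `|y|))); last by rewrite ltr_pM2l // ltrDl.
  by rewrite ler_wpM2r ?mulr_ge0 // ltW.
have [[u Nu]|NN] := pselect (exists u, ~ N u); last first.
  exists 0 => x; rewrite linear0r.
  by apply: contrapT => Nx; apply: NN; exists x.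
have [p Np ort] := orthogonal_projection (ClosedSubspace N0 NP Nc) u.
pose v := u - p.
have v0 : v != 0.
  by apply/eqP => /eqP; rewrite /v subr_eq0 => /eqP up; apply: Nu; rewrite up.
have nv : hdot v v != 0 by rewrite gt_eqF // neq0_dnorm_gt0.
exists ((Num.conj (hdot (f v) y) / hdot v v) *: v) => x.
have := ort (hdot (f v) y *: x - hdot (f x) y *: v).
rewrite linearBr !linearZr_LR /= => /(_ _)/eqP.
rewrite subr_eq0 => H0.
have /H0{H0} : N (hdot (f v) y *: x - hdot (f x) y *: v).
  have fe (a b : R[i]) w : f (a *: x - b *: w) = a *: f x - b *: f w.
    by rewrite linearB !linearZ.
  by rewrite /N /= fe linearBl !linearZl_LR /= mulrC subrr.
move/eqP/(congr1 Num.conj); rewrite !rmorphM /= !conjCK.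
have hC (a b : H) : Num.conj (hdot a b) = hdot b a by rewrite (hermC _ b a) expr0 mul1r.
rewrite !hC -/v => e.
rewrite fmorphV /= hC.
by rewrite mulrAC e mulfK.
Qed.

Definition adj_fun H L (f : bop H L) (y : L) : H :=
  projT1 (cid (riesz_representation f y)).

Lemma adj_funP H L (f : bop H L) x y : hdot (f x) y = hdot x (adj_fun f y).
Proof. by rewrite /adj_fun; case: cid. Qed.

Lemma adj_linear H L (f : bop H L) : linear (adj_fun f).
Proof.
move=> a u v; apply: hdot_inj => x.
by rewrite -adj_funP linearPr [RHS]linearPr /= -!adj_funP.
Qed.
HB.instance Definition _ H L (f : bop H L) :=
  GRing.isLinear.Build R[i] L H *:%R (adj_fun f) (adj_linear f).

Lemma adj_bounded H L (f : bop H L) : bounded_operator (adj_fun f).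
Proof.
have [M M0 fM] := bopP f; exists M => // y.
have [->|g0] := eqVneq (adj_fun f y) 0; first by rewrite normr0 mulr_ge0.
rewrite -(@ler_pM2l _ `|adj_fun f y|) ?normr_gt0 // -expr2 sqr_hnorm -adj_funP.
rewrite -[leLHS]ger0_norm; last by rewrite adj_funP.
rewrite (le_trans (hdot_cauchy_schwarz _ _)) // mulrA (mulrC _ M).
by rewrite ler_wpM2r.
Qed.

Definition adj H L (f : bop H L) : bop L H := Bop (adj_bounded f).

Lemma adjP H L (f : bop H L) x y : hdot (f x) y = hdot x (adj f y).
Proof. exact: adj_funP. Qed.

End Adjoint.

Section ClosedRange.
Variables (R : realType) (H K : hilbertType R) (g : bop H K).

Lemma isometry_closed_range : isometry_op g -> closed (range g).
Proof.
move=> gI x clx.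
pose A (e : R[i]) := [set y | `|x - g y| < e].
pose F := filter_from [set e : R[i] | 0 < e] A.
have FF : ProperFilter F.
  apply: filter_from_proper.
    apply: filter_from_filter; first by exists 1; exact: ltr01.
    move=> i j i0 j0; exists (Num.min i j).
      by rewrite /= /Order.min; case: ifP.
    move=> y; rewrite /A /= /Order.min => xy.
    have /orP ij : (i <= j) || (j <= i).
      by apply: real_leVge; exact: gtr0_real.
    case: ifPn xy => ij' xy.
      by split; [|exact: lt_trans ij'].
    have ji : j <= i.
      by rewrite real_leNgt ?gtr0_real.
    by split; [exact: lt_le_trans ji|].
  move=> e e0; have [_ [[y _ <-]]] := clx _ (nbhsx_ballx x e e0).
  by rewrite -ball_normE; exists y.
have Fc : cauchy F.
  apply: (@cauchy_exP R[i]) => e e0.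
  have e2 : 0 < e / 2 by rewrite divr_gt0.
  have [_ [[y _ <-]]] := clx _ (nbhsx_ballx x _ e2).
  rewrite -ball_normE /= => xy.
  exists y, (e / 2) => // z xz.
  rewrite -ball_normE /= -gI linearB (splitr e).
  rewrite (le_lt_trans (ler_distD x _ _)) // ltrD // distrC //.
have /cvg_ex [p Fp] : cvg F by apply/cauchy_cvgP.
exists p => //; apply/eqP; rewrite eq_sym -subr_eq0 -normr_eq0; apply/negPn/negP => xp.
pose e := `|x - g p| / 2.
have e0 : 0 < e by rewrite divr_gt0 // lt_def xp normr_ge0.
have Fq : F (ball p e) by apply: Fp; exact: nbhsx_ballx.
have FA : F (A e) by exists e.
have [q [pq xq]] := filter_ex (filterI Fq FA).
move: pq; rewrite -ball_normE /= => pq.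
have : `|x - g p| < `|x - g p|.
  rewrite [ltRHS]splitr (le_lt_trans (ler_distD (g q) _ _)) // ltrD //.
  by rewrite distrC -linearB gI.
by rewrite ltxx.
Qed.

End ClosedRange.

Section Restriction.
Variables (R : realType) (K : hilbertType R) (S : closed_subspace K).
Variables (f : bop K K).
Hypothesis fS : forall x, subspace_set S x -> subspace_set S (f x).

Lemma restrict_subproof (x : subspace_sort S) : f (subspace_val x) \in subspace_mem S.
Proof. by apply/subspace_memP/fS/subspace_memP; exact: subspace_valP. Qed.

Definition restrict_fun (x : subspace_sort S) : subspace_sort S :=
  InSubspace (restrict_subproof x).

Lemma restrict_linear : linear restrict_fun.
Proof. by move=> a x y; apply: val_inj; rewrite /= !linearP. Qed.
HB.instance Definition _ :=
  GRing.isLinear.Build R[i] (subspace_sort S) (subspace_sort S) *:%R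
    restrict_fun restrict_linear.

Lemma restrict_bounded : bounded_operator restrict_fun.
Proof. by have [M M0 fM] := bopP f; exists M => // x; exact: fM. Qed.

Definition bop_restrict : bop (subspace_sort S) (subspace_sort S) :=
  Bop restrict_bounded.

End Restriction.

Section UnitaryPart.
Variables (R : realType) (K : hilbertType R) (d : nat).
Variable V : 'I_d -> bop K K.

Definition wold_unitary_set : set K :=
  \bigcap_(n in [set: nat]) range (bexp (bprod V) n).

Record commuting_isometries : Prop := CommutingIsometries {
  ci_commuting : commuting V;
  ci_isometry : forall j, isometry_op (V j) }.

Hypothesis V_ci : commuting_isometries.

Lemma bprod_isometry : isometry_op (bprod V).
Proof.
rewrite /bprod; elim/big_ind: _ => // [f g fI gI x|j _]; last exact: ci_isometry.
by rewrite /= fI gI.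
Qed.

Lemma bexp_isometry n : isometry_op (bexp (bprod V) n).
Proof. by elim: n => // n IHn x /=; rewrite bprod_isometry IHn. Qed.

Lemma bexp_commute j n x : V j (bexp (bprod V) n x) = bexp (bprod V) n (V j x).
Proof.
elim: n x => //= n IHn x; rewrite -IHn; move: (bexp _ _ _) => y.
rewrite /bprod; elim/big_ind: _ y => // [f g fV gV y|i _ y].
  by rewrite /= fV gV.
exact: ci_commuting.
Qed.

Lemma wold_unitary0 : wold_unitary_set 0.
Proof. by move=> n _; exists 0; rewrite ?linear0. Qed.

Lemma wold_unitary_linear (a : R[i]) x y :
  wold_unitary_set x -> wold_unitary_set y -> wold_unitary_set (a *: x + y).
Proof.
move=> Fx Fy n _; have [u _ <-] := Fx n I; have [v _ <-] := Fy n I.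
by exists (a *: u + v); rewrite ?linearP.
Qed.

Lemma wold_unitary_closed : closed wold_unitary_set.
Proof.
by apply: closed_bigI => n _; apply/isometry_closed_range/bexp_isometry.
Qed.

Definition unitary_space : closed_subspace K :=
  ClosedSubspace wold_unitary0 wold_unitary_linear wold_unitary_closed.

Lemma unitary_space_invariant j x :
  subspace_set unitary_space x -> subspace_set unitary_space (V j x).
Proof.
move=> Fx n _; have [u _ <-] := Fx n I.
by exists (V j u); rewrite ?bexp_commute.
Qed.

Definition unitary_part (j : 'I_d) :
    bop (subspace_sort unitary_space) (subspace_sort unitary_space) :=
  bop_restrict (@unitary_space_invariant j).

End UnitaryPart.

Section Dilations.
Variable R : realType.
Implicit Types H K L : hilbertType R.

Definition linear_span K (A : set K) : set K :=
  [set x | exists n (c : 'I_n -> R[i]) (v : 'I_n -> K),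
    (forall i, A (v i)) /\ x = \sum_(i < n) c i *: v i].

(* The inclusion of H in K is represented by a linear isometry iota : H -> K. *)
Record dilation H K d (iota : bop H K) (S : 'I_d -> bop H H)
    (V : 'I_d -> bop K K) : Prop := Dilation {
  dilation_inclusion : isometry_op iota;
  dilation_commuting_base : commuting S;
  dilation_commuting : commuting V;
  dilation_adj : forall i h, adj (V i) (iota h) = iota (adj (S i) h) }.

Record minimal_isometric_dilation H K d (iota : bop H K)
    (S : 'I_d -> bop H H) (V : 'I_d -> bop K K) : Prop :=
  MinimalIsometricDilation {
    mid_dilation : dilation iota S V;
    mid_isometry : forall i, isometry_op (V i);
    mid_minimal :
      closure (linear_span
        [set bprod (fun j => bexp (V j) (nh.1 j)) (iota nh.2) |
          nh in [set: ('I_d -> nat) * H]]) = [set: K] }.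

Lemma mid_commuting_isometries H K d (iota : bop H K) (S : 'I_d -> bop H H)
    (V : 'I_d -> bop K K) :
  minimal_isometric_dilation iota S V -> commuting_isometries V.
Proof. by case=> -[_ _ cV _] iV _; split. Qed.

Definition unitary_operator H (W : bop H H) :=
  (forall x, adj W (W x) = x) /\ (forall x, W (adj W x) = x).

Definition pseudo_extension H L d (T : 'I_d -> bop H H)
    (W : 'I_d -> bop L L) : Prop :=
  commuting W /\
  exists J : bop H L, [/\ exists h, J h != 0, contraction_op J &
    forall j h, J (T j h) = W j (J h)].

Definition unitary_pseudo_extension H L d (T : 'I_d -> bop H H)
    (W : 'I_d -> bop L L) : Prop :=
  pseudo_extension T W /\ forall j, unitary_operator (W j).

End Dilations.

(* Main.v *)
Require Import Defs.
From HB Require Import structures.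
From mathcomp Require Import all_boot all_order all_algebra.
From mathcomp Require Import sesquilinear complex.
From mathcomp Require Import boolp classical_sets functions reals topology.
From mathcomp Require Import normedtype.

Set Implicit Arguments.
Unset Strict Implicit.
Unset Printing Implicit Defensive.
Import Order.TTheory GRing.Theory Num.Theory.
Local Open Scope classical_set_scope.
Local Open Scope ring_scope.

(** Let [F] be the space of the unitary part and [P_F] the orthogonal
    projection of [K] onto [F]. The required contraction is [J = P_F iota].
    Writing [P_F] as the adjoint of the inclusion of [F] into [K], the
    intertwining relation is the adjoint of the fact that [F] is invariant
    under [V j] ([adj_unitary_part_proj]), combined with the dilation property
    [V j^* iota = iota T j].

    Every [V j] maps [F] onto [F] ([unitary_space_surjective]): a vector of [F]
    is the product of all the [V i] applied to a vector of [F], and [V j] can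
    be moved to the front of that product. This has two consequences. First,
    the isometries [V j] restrict to unitaries on [F]. Second, the orthogonal
    complement of [F] is also invariant under every [V j]
    ([unitary_space_ortho_invariant]). Hence, were [J] zero, the complement
    would contain [iota H] together with all its images under the monomials in
    [V]; these span a dense subspace by minimality, so [F] would vanish. *)

Section HilbertSpace.
Variable R : realType.
Implicit Types H K L : hilbertType R.

Lemma hdotC H (x y : H) : hdot x y = Num.conj (hdot y x).
Proof. by rewrite (hermC _ x y) expr0 mul1r. Qed.

Lemma adj_adj H L (f : bop H L) x : adj (adj f) x = f x.
Proof.
by apply: hdot_inj => y; rewrite -adjP hdotC -adjP -hdotC.
Qed.

Lemma adj_contraction H L (f : bop H L) :
  contraction_op f -> contraction_op (adj f).
Proof.
move=> fC y; have [->|g0] := eqVneq (adj f y) 0; first by rewrite normr0.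
rewrite -(@ler_pM2l _ `|adj f y|) ?normr_gt0 // -expr2 sqr_hnorm -adjP.
rewrite -[leLHS]ger0_norm; last by rewrite adjP.
by rewrite (le_trans (hdot_cauchy_schwarz _ _)) // ler_wpM2r.
Qed.

Lemma adj_commuting H d (W : 'I_d -> bop H H) :
  commuting W -> commuting (fun j => adj (W j)).
Proof. by move=> cW i j x; apply: hdot_inj => y; rewrite -!adjP cW. Qed.

Lemma add_sub_inj (F : numDomainType) (a b a' b' : F) :
  a + b = a' + b' -> a - b = a' - b' -> a = a'.
Proof.
move=> D B; apply: (@pmulrnI F 2) => //.
by rewrite !mulr2n -{2}(subrK b a) B addrCA D addrCA subrK.
Qed.

(** Polarization: the norm determines [z + z^*] for [z] the inner product of
    two vectors, and the same expression at ['i * z] recovers [z]. *)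
Lemma isometry_hdot H L (f : bop H L) :
  isometry_op f -> forall x y, hdot (f x) (f y) = hdot x y.
Proof.
move=> fI x y.
have re u v : hdot (f u) (f v) + Num.conj (hdot (f u) (f v)) =
              hdot u v + Num.conj (hdot u v).
  have := congr1 (fun t => t ^+ 2) (fI (u + v)).
  rewrite linearD !sqr_hnorm !dnormD -!sqr_hnorm !fI.
  by move=> /addrI.
have := re ('i *: x) y; rewrite linearZ !linearZl_LR /= !rmorphM /= conjCi.
have := re x y; move: (hdot (f x) (f y)) (hdot x y) => z w.
rewrite !mulNr -!mulrBr => zD /(mulfI (neq0Ci _)) zB.
exact: add_sub_inj zD zB.
Qed.

Lemma isometry_inj H L (f : bop H L) : isometry_op f -> injective f.
Proof.
move=> fI x y fxy; apply/eqP; rewrite -subr_eq0 -normr_eq0 -fI.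
by rewrite linearB fxy subrr normr0.
Qed.

Lemma surjective_isometry_unitary H (f : bop H H) :
  isometry_op f -> (forall y, exists x, f x = y) -> unitary_operator f.
Proof.
move=> fI fS; have fK x : adj f (f x) = x.
  by apply: hdot_inj => y; rewrite -adjP isometry_hdot.
by split=> // y; have [x <-] := fS y; rewrite fK.
Qed.

Lemma adj_unitary H (f : bop H H) :
  unitary_operator f -> unitary_operator (adj f).
Proof. by move=> [fK fV]; split=> x; rewrite adj_adj. Qed.

(** If [f] is orthogonal to [A], no point of [A] is closer to [f] than [0]. *)
Lemma dense_orthogonal H (A : set H) (f : H) :
  closure A = [set: H] -> (forall a, A a -> hdot a f = 0) -> f = 0.
Proof.
move=> dA Af; apply/eqP/negPn/negP => f0.
have nf : 0 < `|f| by rewrite normr_gt0.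
have : closure A f by rewrite dA.
move=> /(_ _ (nbhsx_ballx f _ nf)) [a [Aa]].
rewrite -ball_normE /=; apply/negP.
rewrite -(ltr_pM2r nf) -expr2 le_gtF //.
have -> : `|f| ^+ 2 = `|hdot (f - a) f|.
  by rewrite linearBl /= (Af _ Aa) subr0 -sqr_hnorm ger0_norm // exprn_ge0.
exact: hdot_cauchy_schwarz.
Qed.

Lemma linear_span_orthogonal H (A : set H) (f : H) :
  (forall a, A a -> hdot a f = 0) -> forall x, linear_span A x -> hdot x f = 0.
Proof.
move=> Af _ [n [c [v [Av ->]]]]; rewrite linear_sumlz big1 // => i _.
by rewrite linearZl_LR /= Af // mulr0.
Qed.

Lemma bprod_closed H d (f : 'I_d -> bop H H) (S : set H) :
  (forall j x, S x -> S (f j x)) -> forall x, S x -> S (bprod f x).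
Proof.
move=> fS; rewrite /bprod; elim/big_ind: _ => // [g h gS hS x Sx|j _].
  exact/gS/hS.
exact: fS.
Qed.

Lemma bexp_closed H (f : bop H H) (S : set H) n :
  (forall x, S x -> S (f x)) -> forall x, S x -> S (bexp f n x).
Proof. by move=> fS; elim: n => //= n IHn x Sx; apply/fS/IHn. Qed.

(** Any factor of a product of commuting operators can be moved to the front;
    the remaining product still preserves every subset that is invariant
    under the factors. *)
Lemma bprod_factor H d (f : 'I_d -> bop H H) (S : set H) (j : 'I_d) x :
  commuting f -> (forall i y, S y -> S (f i y)) -> S x ->
  exists2 y, S y & bprod f x = f j y.
Proof.
move=> cf fS Sx; rewrite /bprod; have := mem_index_enum j.
elim: (index_enum _) => // a r IHr.
rewrite inE big_cons /= => /orP[/eqP <-|/IHr[y Sy ->]]; last first.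
  by exists (f a y); [exact: fS | exact: cf].
eexists; last by [].
elim/big_ind: _ x Sx {IHr} => // [g h gS hS x Sx|i _]; last exact: fS.
exact/gS/hS.
Qed.

Lemma subspace_incl_bounded K (S : closed_subspace K) :
  bounded_operator (@subspace_val _ _ S).
Proof. by exists 1 => // x; rewrite mul1r. Qed.
Definition subspace_incl K (S : closed_subspace K) : bop (subspace_sort S) K :=
  Bop (@subspace_incl_bounded K S).

(** As an operator from [K] to the Hilbert space carried by [S], the
    orthogonal projection is the adjoint of the inclusion. *)
Definition subspace_proj K (S : closed_subspace K) : bop K (subspace_sort S) :=
  adj (subspace_incl S).

Lemma subspace_proj_contraction K (S : closed_subspace K) :
  contraction_op (subspace_proj S).
Proof. by apply: adj_contraction => x. Qed.

Lemma subspace_proj_eq0 K (S : closed_subspace K) x :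
  subspace_proj S x = 0 -> forall s, subspace_set S s -> hdot x s = 0.
Proof.
move=> x0 s /subspace_memP Ss.
by rewrite hdotC (adjP (subspace_incl S) (InSubspace Ss)) -/(subspace_proj S)
  x0 linear0r rmorph0.
Qed.

End HilbertSpace.

Section UnitaryPart.
Variables (R : realType) (K : hilbertType R) (d : nat).
Variable V : 'I_d -> bop K K.
Hypothesis V_ci : commuting_isometries V.

(** A preimage [u] of [x] under [bprod V] is unique, so the expansions of [x]
    in the ranges of the higher powers are expansions of [u]. *)
Lemma bprod_unitary_space_surjective x : wold_unitary_set V x ->
  exists2 u, wold_unitary_set V u & bprod V u = x.
Proof.
move=> Fx; have [u _ ux] := Fx 1%N I; exists u => // n _.
have [w _ wx] := Fx n.+1 I; exists w => //.
by apply: (isometry_inj (bprod_isometry V_ci)); rewrite [LHS]wx -[LHS]ux.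
Qed.

Lemma unitary_space_surjective j x : wold_unitary_set V x ->
  exists2 y, wold_unitary_set V y & V j y = x.
Proof.
move=> /bprod_unitary_space_surjective[u Fu <-].
have [y Fy ->] := bprod_factor j (ci_commuting V_ci)
  (@unitary_space_invariant _ _ _ _ V_ci) Fu.
by exists y.
Qed.

Lemma unitary_part_surjective j y : exists x, unitary_part V_ci j x = y.
Proof.
have /subspace_memP/(unitary_space_surjective j)[x Fx xy] := subspace_valP y.
have Ux : x \in subspace_mem (unitary_space V_ci) by apply/subspace_memP.
by exists (InSubspace Ux); apply: val_inj.
Qed.

Lemma unitary_part_unitary j : unitary_operator (unitary_part V_ci j).
Proof.
apply: surjective_isometry_unitary; last exact: unitary_part_surjective.
by move=> x; exact: (ci_isometry V_ci j (subspace_val x)).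
Qed.

Lemma unitary_part_commuting : commuting (unitary_part V_ci).
Proof. by move=> i j x; apply: val_inj; exact: (ci_commuting V_ci). Qed.

Lemma adj_unitary_part_proj j x :
  adj (unitary_part V_ci j) (subspace_proj (unitary_space V_ci) x) =
  subspace_proj (unitary_space V_ci) (adj (V j) x).
Proof. by apply: hdot_inj => y; rewrite -!adjP. Qed.

(** Since [V j] maps [F] onto [F] and preserves inner products, it cannot
    move a vector orthogonal to [F] out of the orthogonal complement. *)
Lemma unitary_space_ortho_invariant j x :
  (forall f, wold_unitary_set V f -> hdot x f = 0) ->
  forall f, wold_unitary_set V f -> hdot (V j x) f = 0.
Proof.
move=> xF f /(unitary_space_surjective j)[g Fg <-].
by rewrite (isometry_hdot (ci_isometry V_ci j)) xF.
Qed.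

End UnitaryPart.

(** The orthogonal complement of [F] is invariant under all monomials in [V].
    If it contains the base space, then by minimality it is dense, which leaves
    only [0] in [F]. *)
Lemma minimal_dilation_unitary_space_eq0 (R : realType) (d : nat)
    (H K : hilbertType R) (iota : bop H K) (S : 'I_d -> bop H H)
    (V : 'I_d -> bop K K) :
  minimal_isometric_dilation iota S V ->
  (forall h f, wold_unitary_set V f -> hdot (iota h) f = 0) ->
  wold_unitary_set V = [set 0].
Proof.
move=> dilV HF; have V_ci := mid_commuting_isometries dilV.
apply/seteqP; split=> [f Ff|_ ->]; last exact: wold_unitary0.
apply: (dense_orthogonal (mid_minimal dilV)).
apply: linear_span_orthogonal => _ [[n h] _ <-] /=.
pose Fperp := [set x | forall f, wold_unitary_set V f -> hdot x f = 0].
have : Fperp (iota h) by move=> g; exact: HF.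
move=> /(@bprod_closed _ _ _ (fun j => bexp (V j) (n j)) Fperp) -> //.
move=> j x; apply: bexp_closed => {}x.
exact: unitary_space_ortho_invariant.
Qed.

Theorem theorem2p5 (R : realType) (d : nat) (H K : hilbertType R)
    (T : 'I_d -> bop H H) (iota : bop H K) (V : 'I_d -> bop K K)
    (commT : commuting T) (contrT : forall j, contraction_op (T j))
    (dilV : minimal_isometric_dilation iota (fun j => adj (T j)) V)
    (unitary_part_nonzero : wold_unitary_set V <> [set 0]) :
  unitary_pseudo_extension T
    (fun j => adj (unitary_part (mid_commuting_isometries dilV) j)).
Proof.
set V_ci := mid_commuting_isometries dilV.
have [iotaI _ _ iotaV] := mid_dilation dilV.
split; last by move=> j; exact/adj_unitary/unitary_part_unitary.
split; first exact/adj_commuting/unitary_part_commuting.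
exists (bcomp (subspace_proj (unitary_space V_ci)) iota); split.
- apply: contrapT => J0; apply: unitary_part_nonzero.
  apply: (minimal_dilation_unitary_space_eq0 dilV) => h.
  apply: (@subspace_proj_eq0 _ _ (unitary_space V_ci)).
  by apply/eqP/negPn/negP => Jh; apply: J0; exists h.
- by move=> h; rewrite -(iotaI h); exact: subspace_proj_contraction.
- by move=> j h; rewrite /= adj_unitary_part_proj iotaV adj_adj.
Qed.
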